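(* For a monoid $A$, a fixed finitely generated ideal $\mathfrak{a}$ of $A$ and any ideal $I$ of $A$, set $I^{\mathfrak{a}\text{-}sat}:=\bigcup_{n\in\mathbb{N}}(I:\mathfrak{a}^n)=\{x\in A\mid\exists\,n\in\mathbb{N}\text{ such that }\mathfrak{a}^nx\subseteq I\}$. Then: (1) $I\mapsto I^{\mathfrak{a}\text{-}sat}$ defines a closure operation on the collection of all ideals of $A$ (the $\mathfrak{a}$-saturation closure operation). (2) Consider the subcategory $\mathcal{M}$ of Noetherian monoids whose morphisms are surjective local morphisms. Saturation closure with respect to the unique maximal ideal of each monoid (i.e. $I\mapsto I^{m_A\text{-}sat}$ on each $A\in\mathcal{M}$) is persistent on $\mathcal{M}$ and commutes with localization.
   Context: $\mathbb{N}=\{1,2,\ldots\}$. A monoid means a commutative monoid, written multiplicatively, with identity $1$ and a base point $0$ satisfying $0\cdot a=0$; morphisms preserve products, $1$ and $0$. An ideal $I\subseteq A$ is a subset containing $0$ with $IA\subseteq I$; it is finitely generated if there is a finite $Y\subseteq I$ with every $x\in I$ of the form $ay$, $a\in A$, $y\in Y$. A monoid is Noetherian if all its ideals are finitely generated. $\mathfrak{a}^n:=\{\prod_{i=1}^n x_i\mid x_i\in\mathfrak{a}\}$. The non-units of $A$ form its unique maximal ideal $m_A$; a morphism $f:A\to B$ is local if $f(m_A)\subseteq m_B$. A closure operation on the set of ideals of $A$ is a map $I\mapsto I^{cl}$ from this set to itself with $I\subseteq I^{cl}$; $I\subseteq J\Rightarrow I^{cl}\subseteq J^{cl}$; $(I^{cl})^{cl}=I^{cl}$.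 Let $cl$ be a closure operation defined on the ideals of all monoids in a subcategory $\mathcal{M}$ of monoids. It is persistent on $\mathcal{M}$ if for every morphism $\phi:A\to B$ in $\mathcal{M}$ and every ideal $I$ of $A$, $\phi(I^{cl})B\subseteq(\phi(I)B)^{cl}$. A persistent $cl$ commutes with localization in $\mathcal{M}$ if for every $A\in\mathcal{M}$ and every multiplicative set $S\subseteq A$ such that the localization map $A\to S^{-1}A$ is in $\mathcal{M}$, $S^{-1}(I^{cl})=(S^{-1}I)^{cl}$ for every ideal $I$ of $A$. Here $S^{-1}A$ is the monoid of fractions $a/s$, with $a/s=b/t$ iff $uta=usb$ for some $u\in S$. *)

(* Defs.v *)
From HB Require Import structures.
From mathcomp Require Import all_boot.
From mathcomp Require Import monoid generic_quotient.
From mathcomp Require Import boolp classical_sets functions cardinality.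

Set Implicit Arguments.
Unset Strict Implicit.
Unset Printing Implicit Defensive.

Local Open Scope quotient_scope.
Local Open Scope group_scope.
Local Open Scope classical_set_scope.

(* Commutative monoids, written multiplicatively, with an absorbing base point.
   [0 <> 1] is not required, so the one-point monoid is included. *)
HB.mixin Record Monoid_isPointed A of Monoid A := {
  pmulC : forall x y : A, x * y = y * x;
  pzero : A;
  pmul0 : forall x : A, pzero * x = pzero
}.

#[short(type="pmonoidType")]
HB.structure Definition PMonoid := {A of Monoid_isPointed A & Monoid A}.

Lemma pmulAC (A : pmonoidType) (x y z : A) : x * y * z = x * z * y.
Proof. by rewrite -mulgA (pmulC y) mulgA. Qed.

Lemma pmulCA (A : pmonoidType) (x y z : A) : x * (y * z) = y * (x * z).
Proof. by rewrite mulgA (pmulC x) mulgA. Qed.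

Lemma pmulACA (A : pmonoidType) (x y z t : A) :
  (x * y) * (z * t) = (x * z) * (y * t).
Proof. by rewrite -!mulgA (pmulCA y). Qed.

HB.mixin Record isPointedMorphism (A B : pmonoidType) (f : A -> B) := {
  pmorph0 : f pzero = pzero
}.

HB.structure Definition PMonoidMorphism (A B : pmonoidType) :=
  {f of isPointedMorphism A B f & @UMagmaMorphism A B f}.

Notation "{ 'pmorphism' A -> B }" := (PMonoidMorphism.type A B)
  (at level 0, A at level 98, B at level 99,
   format "{ 'pmorphism'  A  ->  B }") : type_scope.

HB.instance Definition _ (A : pmonoidType) :=
  isPointedMorphism.Build A A idfun erefl.

Section Composition.
Variables (A B C : pmonoidType) (g : {pmorphism B -> C}) (f : {pmorphism A -> B}).

Fact comp_pmorph0 : (g \o f) pzero = pzero.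
Proof. by rewrite /= !pmorph0. Qed.

HB.instance Definition _ := isPointedMorphism.Build A C (g \o f) comp_pmorph0.
End Composition.

Section Ideals.
Variable A : pmonoidType.
Implicit Types (I J Y : set A) (a x y : A).

Definition is_ideal I := I pzero /\ forall x a, I x -> I (x * a).

Definition finitely_generated I :=
  exists Y, [/\ finite_set Y, Y `<=` I &
    forall x, I x -> exists a y, Y y /\ x = a * y].

Definition noetherian := forall I, is_ideal I -> finitely_generated I.

Definition is_unit x := exists y, x * y = 1.

(* An ideal as soon as [A] is not the one-point monoid, in which every element
   is a unit and this set is empty. *)
Definition max_ideal : set A := [set x | ~ is_unit x].

Definition ideal_pow I (n : nat) : set A :=
  [set \prod_(i < n) x i | x in [set x : 'I_n -> A | forall i, I (x i)]].

Definition colon I J : set A := [set x | forall y, J y -> I (y * x)].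

Definition saturation J I : set A :=
  \bigcup_(n in [set n | (0 < n)%N]) colon I (ideal_pow J n).

Definition closure_operation (cl : set A -> set A) :=
  [/\ forall I, is_ideal I -> is_ideal (cl I),
      forall I, is_ideal I -> I `<=` cl I,
      forall I J, is_ideal I -> is_ideal J -> I `<=` J -> cl I `<=` cl J &
      forall I, is_ideal I -> cl (cl I) = cl I].

End Ideals.

Arguments max_ideal : clear implicits.
Arguments noetherian : clear implicits.

Definition max_saturation (A : pmonoidType) (I : set A) : set A :=
  saturation (max_ideal A) I.

Definition is_local (A B : pmonoidType) (f : {pmorphism A -> B}) :=
  f @` max_ideal A `<=` max_ideal B.

(* [X B], the ideal generated by a nonempty subset [X] of [B]. *)
Definition extension (B : pmonoidType) (X : set B) : set B :=
  [set x * b | x in X & b in [set: B]].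

Record mult_set (A : pmonoidType) := MultSet {
  mset :> set A;
  mset1 : mset 1;
  msetM : forall s t, mset s -> mset t -> mset (s * t)
}.

Section Localization.
Variables (A : pmonoidType) (S : mult_set A).

Definition denom : choiceType := {s : A | `[< mset S s >]}.

Definition mk_denom s (Ss : mset S s) : denom :=
  exist (fun s => `[< mset S s >]) s (asboolT Ss).

Lemma denomP (s : denom) : mset S (val s).
Proof. exact: asboolW (valP s). Qed.

Definition denom1 := mk_denom (mset1 S).
Definition denomM (s t : denom) := mk_denom (msetM (denomP s) (denomP t)).

(* [(a, s)] stands for the fraction [a / s]. *)
Definition frac_eq (p q : A * denom) : bool :=
  `[< exists u, mset S u /\ u * val q.2 * p.1 = u * val p.2 * q.1 >].

Fact frac_eq_refl : reflexive frac_eq.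
Proof. by move=> p; apply/asboolP; exists 1; split => //; apply: mset1. Qed.

Fact frac_eq_sym : symmetric frac_eq.
Proof.
by move=> p q; apply/asboolP/asboolP => -[u [Su e]]; exists u; split.
Qed.

Fact frac_eq_trans : transitive frac_eq.
Proof.
move=> [b t] [a s] [c r] /asboolP[/= u [Su e]] /asboolP[/= v [Sv h]].
apply/asboolP => /=; exists (u * v * val t); split.
  by apply: msetM; [exact: msetM|exact: denomP].
rewrite (pmulAC u) -(mulgA (u * _)) (pmulAC (u * _) (v * _) a) e.
rewrite -mulgA (pmulC b) h !mulgA (pmulAC u (val s) v) (pmulAC u (val t) v).
by rewrite (pmulAC (u * v) (val s)).
Qed.

Canonical frac_equiv := EquivRel frac_eq frac_eq_refl frac_eq_sym frac_eq_trans.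

Definition localization := {eq_quot frac_equiv}.
HB.instance Definition _ : EqQuotient _ frac_equiv localization :=
  EqQuotient.on localization.
HB.instance Definition _ := Choice.on localization.

Definition frac (a : A) (s : denom) : localization := \pi_localization (a, s).

Lemma fracP a s b t :
  frac a s = frac b t <->
  exists u, mset S u /\ u * val t * a = u * val s * b.
Proof.
rewrite /frac; split => [/eqP|e]; last by apply/eqP; rewrite piE; apply/asboolP.
by rewrite piE => /asboolP.
Qed.

Lemma frac_repr (x : localization) : x = frac (repr x).1 (repr x).2.
Proof. by rewrite /frac -surjective_pairing reprK. Qed.

Definition loc_one : localization := frac 1 denom1.
Definition loc_zero : localization := frac pzero denom1.
Definition loc_mul (x y : localization) : localization :=
  frac ((repr x).1 * (repr y).1) (denomM (repr x).2 (repr y).2).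

Lemma loc_mulE a s b t :
  loc_mul (frac a s) (frac b t) = frac (a * b) (denomM s t).
Proof.
rewrite /loc_mul.
move: (frac_repr (frac a s)) (frac_repr (frac b t)).
case: (repr (frac a s)) (repr (frac b t)) => [a' s'] [b' t'] /=.
move=> /fracP[u [Su e]] /fracP[v [Sv h]].
apply/fracP; exists (u * v); split; first exact: msetM.
by rewrite /= !(pmulACA u v) !(pmulACA (u * _) (v * _)) e h.
Qed.

Fact loc_mulA : associative loc_mul.
Proof.
move=> x y z; rewrite (frac_repr x) (frac_repr y) (frac_repr z) !loc_mulE.
by apply/fracP; exists 1; split; [exact: mset1|rewrite /= !mulgA].
Qed.

Fact loc_mulC : commutative loc_mul.
Proof.
move=> x y; rewrite (frac_repr x) (frac_repr y) !loc_mulE.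
apply/fracP; exists 1; split; first exact: mset1.
by rewrite /= (pmulC (val (repr x).2)) (pmulC (repr x).1).
Qed.

Fact loc_mul1 : left_id loc_one loc_mul.
Proof.
move=> x; rewrite (frac_repr x) loc_mulE.
by apply/fracP; exists 1; split; [exact: mset1|rewrite /= !mul1g].
Qed.

Fact loc_mulr1 : right_id loc_one loc_mul.
Proof. by move=> x; rewrite loc_mulC loc_mul1. Qed.

Fact loc_mul0 (x : localization) : loc_mul loc_zero x = loc_zero.
Proof.
rewrite (frac_repr x) loc_mulE pmul0; apply/fracP; exists 1.
by split; [exact: mset1|rewrite ![_ * pzero]pmulC !pmul0].
Qed.

HB.instance Definition _ :=
  isMonoid.Build localization loc_mulA loc_mul1 loc_mulr1.
HB.instance Definition _ :=
  Monoid_isPointed.Build localization loc_mulC loc_mul0.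

Definition loc_map (a : A) : localization := frac a denom1.

Fact loc_map_morphism : monoid_morphism loc_map.
Proof.
split=> // a b; rewrite -[RHS]/(loc_mul _ _) loc_mulE.
by apply/fracP; exists 1; split; [exact: mset1|rewrite /= !mul1g].
Qed.

HB.instance Definition _ :=
  isUMagmaMorphism.Build A localization loc_map loc_map_morphism.

Fact loc_map0 : loc_map pzero = pzero.
Proof. by []. Qed.

HB.instance Definition _ :=
  isPointedMorphism.Build A localization loc_map loc_map0.

Definition loc_ideal (I : set A) : set localization :=
  [set frac a s | a in I & s in [set: denom]].

End Localization.

Arguments loc_ideal {A} S I.

Record subcategory := Subcategory {
  cat_ob : pmonoidType -> Prop;
  cat_hom : forall A B : pmonoidType, {pmorphism A -> B} -> Prop;
  cat_dom : forall A B (f : {pmorphism A -> B}), cat_hom f -> cat_ob A;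
  cat_cod : forall A B (f : {pmorphism A -> B}), cat_hom f -> cat_ob B;
  cat_id : forall A, cat_ob A -> cat_hom (idfun : {pmorphism A -> A});
  cat_comp : forall A B C (g : {pmorphism B -> C}) (f : {pmorphism A -> B}),
    cat_hom g -> cat_hom f -> cat_hom (g \o f : {pmorphism A -> C})
}.

Section ClosureOnSubcategory.
Variables (M : subcategory) (cl : forall A : pmonoidType, set A -> set A).

Definition closure_operation_on :=
  forall A, cat_ob M A -> closure_operation (@cl A).

Definition persistent :=
  forall A B (phi : {pmorphism A -> B}), cat_hom M phi ->
  forall I : set A, is_ideal I ->
  extension (phi @` cl I) `<=` cl (extension (phi @` I)).

Definition commutes_with_localization :=
  forall A (S : mult_set A), cat_ob M A ->
  cat_hom M (loc_map S : {pmorphism A -> localization S}) ->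
  forall I : set A, is_ideal I -> loc_ideal S (cl I) = cl (loc_ideal S I).

End ClosureOnSubcategory.

Section NoetherianSurjectiveLocal.

Definition noeth_hom (A B : pmonoidType) (f : {pmorphism A -> B}) :=
  [/\ noetherian A, noetherian B,
      set_surj [set: A] [set: B] f & is_local f].

Fact noeth_dom A B (f : {pmorphism A -> B}) : noeth_hom f -> noetherian A.
Proof. by case. Qed.

Fact noeth_cod A B (f : {pmorphism A -> B}) : noeth_hom f -> noetherian B.
Proof. by case. Qed.

Fact noeth_id (A : pmonoidType) :
  noetherian A -> noeth_hom (idfun : {pmorphism A -> A}).
Proof. by split=> // y [x mx <-]. Qed.

Fact noeth_comp A B C (g : {pmorphism B -> C}) (f : {pmorphism A -> B}) :
  noeth_hom g -> noeth_hom f -> noeth_hom (g \o f : {pmorphism A -> C}).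
Proof.
move=> [nB nC gs gl] [nA _ fs fl]; split=> // [z _|z [x mx <-]].
  by have [y _ <-] := gs z I; have [x _ <-] := fs y I; exists x.
by apply: gl; exists (f x) => //; apply: fl; exists x.
Qed.

Definition noetherian_surjective_local : subcategory :=
  Subcategory noeth_dom noeth_cod noeth_id noeth_comp.

End NoetherianSurjectiveLocal.

(* Main.v *)
Require Import Defs.
From mathcomp Require Import all_boot boolp classical_sets.
From mathcomp Require Import monoid functions cardinality.

(** The only point of part (1) that is not formal is idempotence, and there
    finite generation enters.  If [J y x] lies in the saturation of [I] for
    every [y] in [J], then each of the finitely many generators [y] of [J] comes
    with an exponent [n] such that [J^n y x] lies in [I]; since the colons
    [(I : J^n)] increase with [n], one exponent serves all generators, hence all
    of [J], and [J^(n+1) x] lies in [I] ([saturation_colon]).  Iterating this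
    strips the factors of a power [J^n] one by one ([saturation_idem]).

    In part (2), the closure operation is an instance of part (1), except that
    in the one-point monoid the set of non-units is empty, hence not an ideal;
    it is then generated by the empty set ([max_ideal_fg]).
    Persistence holds along every surjective morphism [phi : A -> B]: units map
    to units, so the non-units of [B] are images of non-units of [A], and
    powers follow ([max_ideal_pow_surj]).

    For localization, the hypothesis that [A -> S^-1 A] is local is very strong:
    elements of [S] become invertible, so they were already units of [A]
    ([local_denom_unit]).  Thus fractions can be compared in [A] itself: [a / s]
    lies in [S^-1 I] if and only if [a] lies in [I] ([loc_ideal_frac]), and the
    powers of the two maximal ideals determine each other. *)

Set Implicit Arguments.
Unset Strict Implicit.
Unset Printing Implicit Defensive.

Local Open Scope group_scope.
Local Open Scope classical_set_scope.

(** * Powers of a set and saturation *)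

Section Saturation.
Variable A : pmonoidType.
Implicit Types (I J : set A) (x y : A).

Lemma ideal_pow0 J x : ideal_pow J 0 x <-> x = 1.
Proof.
split=> [[f _ <-]|->]; first by rewrite big_ord0.
by exists (fun=> 1); [case|rewrite big_ord0].
Qed.

Lemma ideal_powS J n x :
  ideal_pow J n.+1 x <-> exists y z, [/\ J y, ideal_pow J n z & x = y * z].
Proof.
split=> [[f Jf <-]|[y [_ [Jy [f Jf <-] ->]]]].
  exists (f ord0), (\prod_(i < n) f (lift ord0 i)).
  by split; [exact: Jf|exists (f \o lift ord0) => // i; exact: Jf|
    rewrite big_ord_recl].
exists (fun i => oapp f y (unlift ord0 i)).
  by move=> i; case: unlift => [j|] //=; exact: Jf.
rewrite big_ord_recl unlift_none; congr (_ * _).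
by apply: eq_bigr => i _; rewrite liftK.
Qed.

Lemma ideal_pow1 J x : ideal_pow J 1 x <-> J x.
Proof.
rewrite ideal_powS; split=> [[y [z [Jy /ideal_pow0 -> ->]]]|Jx].
  by rewrite mulg1.
by exists x, 1; split=> //; [exact/ideal_pow0|rewrite mulg1].
Qed.

Lemma sub_ideal_pow I J n : I `<=` J -> ideal_pow I n `<=` ideal_pow J n.
Proof. by move=> IJ _ [f If <-]; exists f => // i; exact/IJ/If. Qed.

(** The colon formula [(I : J^(n+1)) = ((I : J^n) : J)], which makes every
    statement about powers amenable to induction. *)
Lemma colon_powS I J n x : colon I (ideal_pow J n.+1) x <->
  forall y, J y -> colon I (ideal_pow J n) (y * x).
Proof.
split=> [Ix y Jy z Jz|Ix _ /ideal_powS[y [z [Jy Jz ->]]]].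
  by rewrite mulgA (pmulC z); apply: Ix; apply/ideal_powS; exists y, z.
by rewrite (pmulC y) -mulgA; apply: Ix.
Qed.

Lemma colon_ideal I J : is_ideal I -> is_ideal (colon I J).
Proof.
move=> [I0 IM]; split=> [y _|x b Ix y Jy]; first by rewrite pmulC pmul0.
by rewrite mulgA; apply/IM/Ix.
Qed.

Lemma sub_colon I J : is_ideal I -> I `<=` colon I J.
Proof. by move=> [_ IM] x Ix y _; rewrite pmulC; apply: IM. Qed.

Lemma colon_pow_le I J m n : is_ideal I -> (m <= n)%N ->
  colon I (ideal_pow J m) `<=` colon I (ideal_pow J n).
Proof.
move=> Iid /subnKC <-; elim: (n - m)%N => [|k IHk] x Ix; first by rewrite addn0.
rewrite addnS; apply/colon_powS => y _; rewrite pmulC.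
by have [_] := colon_ideal (ideal_pow J (m + k)) Iid; apply; exact: IHk.
Qed.

Lemma saturation_ideal I J : is_ideal I -> is_ideal (saturation J I).
Proof.
move=> Iid; split=> [|x b [n n_gt0 Ix]].
  by exists 1%N => //; have [] := colon_ideal (ideal_pow J 1) Iid.
by exists n => //; have [_] := colon_ideal (ideal_pow J n) Iid; apply.
Qed.

Lemma sub_saturation I J : is_ideal I -> I `<=` saturation J I.
Proof. by move=> Iid x Ix; exists 1%N => //; exact: sub_colon. Qed.

Lemma saturationS I I' J : I `<=` I' -> saturation J I `<=` saturation J I'.
Proof. by move=> II' x [n n_gt0 Ix]; exists n => // y Jy; apply/II'/Ix. Qed.

(** The exponents witnessing membership can be replaced by their maximum,
    because the colons form an increasing chain. *)
Lemma saturation_seq I J x (s : seq A) : is_ideal I ->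
    (forall y, y \in s -> saturation J I (y * x)) ->
  exists n, forall y, y \in s -> colon I (ideal_pow J n) (y * x).
Proof.
move=> Iid; elim: s => [|z s IHs] sI; first by exists 0%N.
have [m _ Iz] := sI z (mem_head _ _).
have [y ys|n In] := IHs; first by apply: sI; rewrite inE ys orbT.
exists (maxn m n) => y; rewrite inE => /predU1P[->|/In Iy].
  exact: colon_pow_le (leq_maxl m n) _ Iz.
exact: colon_pow_le (leq_maxr m n) _ Iy.
Qed.

(** A generator [y] satisfies [J^n y x] in [I] with [n] common to all
    generators; multiples of [y] inherit this as the colon is an ideal, so
    [J^(n+1) x] lies in [I]. *)
Lemma saturation_colon I J x : is_ideal I -> finitely_generated J ->
  (forall y, J y -> saturation J I (y * x)) -> saturation J I x.
Proof.
move=> Iid [Y [/finite_seqP[s ->] sJ genJ]] JI.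
have [n In] := saturation_seq Iid (fun y ys => JI y (sJ y ys)).
exists n.+1 => //; apply/colon_powS => _ /genJ[b [y [ys ->]]].
rewrite -mulgA pmulC.
by have [_] := colon_ideal (ideal_pow J n) Iid; apply; exact: In.
Qed.

Lemma saturation_idem I J : is_ideal I -> finitely_generated J ->
  saturation J (saturation J I) = saturation J I.
Proof.
move=> Iid fgJ; apply/seteqP; split; last first.
  exact/sub_saturation/saturation_ideal.
move=> x [n _]; elim: n x => [|n IHn] x Ix.
  by rewrite -[x]mul1g; apply: Ix; apply/ideal_pow0.
by apply: saturation_colon => // y Jy; apply: IHn; move/colon_powS: Ix; apply.
Qed.

Lemma saturation_closure J :
  finitely_generated J -> closure_operation (saturation J).
Proof.
move=> fgJ; split=> [I|I|I I' _ _|I Iid]; first exact: saturation_ideal.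
- exact: sub_saturation.
- exact: saturationS.
- exact: saturation_idem.
Qed.

End Saturation.

(** * The maximal ideal and its behaviour under morphisms *)

Section MaxIdeal.
Variable A : pmonoidType.
Implicit Types x y : A.

Lemma is_unit_mull x y : is_unit (x * y) -> is_unit x.
Proof. by move=> [z xyz]; exists (y * z); rewrite mulgA. Qed.

Lemma is_unitM x y : is_unit x -> is_unit y -> is_unit (x * y).
Proof.
by move=> [x' xx'] [y' yy']; exists (x' * y'); rewrite pmulACA xx' yy' mulg1.
Qed.

Lemma is_unit_ideal (I : set A) x y :
  is_ideal I -> is_unit x -> I (x * y) -> I y.
Proof.
by move=> [_ IM] [z xz] Ixy; rewrite -[y]mul1g -xz pmulAC; exact: IM.
Qed.

Lemma max_ideal_fg : noetherian A -> finitely_generated (max_ideal A).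
Proof.
move=> nA; have [U0|U0] := pselect (is_unit (pzero : A)).
  (* When [0] is a unit, so is everything, and the empty set generates. *)
  exists set0; split=> // x []; apply: (@is_unit_mull x pzero).
  by rewrite pmulC pmul0.
by apply: nA; split=> // x b Ux /is_unit_mull.
Qed.

End MaxIdeal.

Section Morphisms.
Variables (A B : pmonoidType) (f : {pmorphism A -> B}).

Lemma is_unit_morph x : is_unit x -> is_unit (f x).
Proof. by move=> [y xy]; exists (f y); rewrite -gmulfM xy gmulf1. Qed.

Lemma image_ideal_pow (J : set A) n :
  f @` ideal_pow J n = ideal_pow (f @` J) n.
Proof.
elim: n => [|n IHn].
  apply/seteqP; split=> [_ [x /ideal_pow0 -> <-]|x /ideal_pow0 ->].
    by apply/ideal_pow0; rewrite gmulf1.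
  by exists 1; [exact/ideal_pow0|rewrite gmulf1].
apply/seteqP; split=> [_ [_ /ideal_powS[y [z [Jy Jz ->]]] <-]|x].
  apply/ideal_powS; exists (f y), (f z); split; [exact: imageP| |exact: gmulfM].
  by rewrite -IHn; exact: imageP.
move=> /ideal_powS[_ [z [[y Jy <-]]]]; rewrite -IHn => -[t Jt <-] ->.
by exists (y * t); [apply/ideal_powS; exists y, t|rewrite gmulfM].
Qed.

Lemma max_ideal_pow_surj n : set_surj [set: A] [set: B] f ->
  ideal_pow (max_ideal B) n `<=` f @` ideal_pow (max_ideal A) n.
Proof.
move=> fs; rewrite image_ideal_pow; apply: sub_ideal_pow => y.
by have [x _ <-] := fs y I => Ufx; exists x => // /is_unit_morph.
Qed.

Lemma max_ideal_pow_local n : is_local f ->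
  f @` ideal_pow (max_ideal A) n `<=` ideal_pow (max_ideal B) n.
Proof. by move=> fl; rewrite image_ideal_pow; exact: sub_ideal_pow. Qed.

(** An element of the [n]-th power of the maximal ideal of [B] is [f y] with [y]
    in the [n]-th power of that of [A], so the exponent [n] that works for [x]
    works for [f x]. *)
Lemma max_saturation_persistent (I : set A) :
  set_surj [set: A] [set: B] f ->
  extension (f @` max_saturation I) `<=` max_saturation (extension (f @` I)).
Proof.
move=> fs _ [_ [x [n n_gt0 Ix] <-] [b _ <-]]; exists n => //.
move=> _ /(max_ideal_pow_surj fs)[y my <-].
exists (f (y * x)); first by apply: imageP; exact: Ix.
by exists b => //; rewrite gmulfM mulgA.
Qed.

End Morphisms.

(** * Localization *)

Section Localization.
Variables (A : pmonoidType) (S : mult_set A).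

Lemma denom_unit (s : denom S) : is_unit (loc_map S (val s)).
Proof.
exists (frac 1 s); rewrite -[LHS]/(loc_mul _ _) loc_mulE.
by apply/fracP; exists 1; split; [exact: mset1|rewrite /= !mul1g !mulg1].
Qed.

(** A non-unit of [S] would be sent by the local morphism to a non-unit, yet
    [1 / s] inverts it. *)
Lemma local_denom_unit (s : A) :
  is_local (loc_map S : {pmorphism A -> localization S}) ->
  mset S s -> is_unit s.
Proof.
move=> loc Ss; apply: contrapT => Us; apply: (loc (loc_map S s)).
  by exists s.
exact: (denom_unit (mk_denom Ss)).
Qed.

Lemma loc_map_frac a b s : loc_map S a * frac b s = frac (a * b) s.
Proof.
rewrite -[LHS]/(loc_mul _ _) loc_mulE; apply/fracP; exists 1.
by split; [exact: mset1|rewrite /= !mul1g].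
Qed.

Hypothesis loc : is_local (loc_map S : {pmorphism A -> localization S}).

Lemma loc_ideal_frac (I : set A) a s :
  is_ideal I -> loc_ideal S I (frac a s) <-> I a.
Proof.
move=> Iid; split=> [[b Ib [t _ /fracP[u [Su e]]]]|Ia]; last first.
  by exists a => //; exists s.
(* The equation reads [u s b = u t a], where [u] and [t] are units. *)
apply: (@is_unit_ideal _ _ (u * val t)) => //.
  by apply: is_unitM; apply: local_denom_unit => //; exact: denomP.
by rewrite -e pmulC; have [_ IM] := Iid; exact: IM.
Qed.

(** Surjectivity writes a product of non-units of [S^-1 A] as the image of a
    product of non-units of [A], for the direct inclusion; locality gives the
    other one. *)
Lemma max_saturation_loc (I : set A) :
  set_surj [set: A] [set: localization S] (loc_map S) -> is_ideal I ->
  loc_ideal S (max_saturation I) = max_saturation (loc_ideal S I).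
Proof.
move=> surj Iid; apply/seteqP; split=> [_ [a [n n_gt0 Ia] [s _ <-]]|z].
  exists n => // _ /(max_ideal_pow_surj surj)[y my <-].
  by rewrite loc_map_frac; apply/loc_ideal_frac => //; exact: Ia.
rewrite (frac_repr z) => -[n n_gt0 Iz].
apply/loc_ideal_frac; first exact: saturation_ideal.
exists n => // y my; apply/(loc_ideal_frac _ (repr z).2 Iid).
rewrite -loc_map_frac; apply/Iz/(max_ideal_pow_local loc).
exact: imageP.
Qed.

End Localization.

Theorem proposition4p9 :
  (forall (A : pmonoidType) (a : set A),
     is_ideal a -> finitely_generated a -> closure_operation (saturation a)) /\
  [/\ closure_operation_on noetherian_surjective_local max_saturation,
      persistent noetherian_surjective_local max_saturation &
      commutes_with_localization noetherian_surjective_local max_saturation].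
Proof.
split=> [A a _|]; first exact: saturation_closure.
split=> [A nA|A B f [_ _ surj _] I _|A S _ [_ _ surj loc] I].
- exact/saturation_closure/max_ideal_fg.
- exact: max_saturation_persistent.
- exact: max_saturation_loc.
Qed.
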